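(* Let $\{P^{[n]}\in\mathbb{R}^{n\times n}\}_{n\in\mathbb{N}}$ be a sequence of (row-)stochastic matrices of increasing dimensions, with the opinion dynamics and wisdom notions described in the context. Then: (i) the sequence is one-time wise if and only if $\lim_{n\to\infty}\|\tfrac{1}{n}P^{[n]}\|_1=0$; (ii) the sequence is finite-time wise if and only if, for every $k\in\mathbb{N}$, $\lim_{n\to\infty}\|\tfrac{1}{n}(P^{[n]})^k\|_1=0$. Moreover, if every $P^{[n]}$ is primitive, then (iii) the sequence is wise if and only if $\lim_{n\to\infty}\|\pi^{[n]}\|_\infty=0$, where $\pi^{[n]}$ is the left dominant eigenvector of $P^{[n]}$ (the unique $\pi^{[n]}\ge 0$ with entries summing to $1$ and $(\pi^{[n]})^\top P^{[n]}=(\pi^{[n]})^\top$).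
   Context: A matrix $P\in\mathbb{R}^{n\times n}$ is stochastic if $P\ge 0$ entrywise and $P\mathbf{1}_n=\mathbf{1}_n$. For nonnegative $P$, $\|P\|_1=\max_{j}\sum_{i=1}^n P_{ij}$ is the maximum column sum. $P$ is primitive if its associated directed graph (edge $(i,j)$ iff $P_{ij}>0$) is strongly connected and aperiodic. For $x\in\mathbb{R}^n$, $\mathrm{ave}(x)=\frac1n\sum_i x_i$. Setting: for each $n$, let $x^{[n]}(0)\in\mathbb{R}^n$ with $x^{[n]}_i(0)=\mu+\xi^{[n]}_i(0)$, where $\mu\in\mathbb{R}$ is a fixed constant and $\xi^{[n]}_1(0),\dots,\xi^{[n]}_n(0)$ are independent Gaussian random variables with mean $0$ and common variance $\sigma^2\in(0,\infty)$; and let $x^{[n]}(k+1)=P^{[n]}x^{[n]}(k)$ for $k\ge 0$. The sequence $\{P^{[n]}\}$ is called: one-time wise if $\lim_{n\to\infty}\mathrm{ave}(x^{[n]}(1))=\mu$; finite-time wise if $\lim_{n\to\infty}\mathrm{ave}(x^{[n]}(k))=\mu$ for all $k\in\mathbb{N}$; wise if $\lim_{n\to\infty}\lim_{k\to\infty}\mathrm{ave}(x^{[n]}(k))=\mu$. All limits in $n$ are in probability. *)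

(* Defs.v *)
From HB Require Import structures.
From mathcomp Require Import all_boot all_order all_algebra.
From mathcomp Require Import all_classical all_reals all_analysis.
Set Implicit Arguments. Unset Strict Implicit. Unset Printing Implicit Defensive.
Import Order.TTheory GRing.Theory Num.Theory.
Import numFieldNormedType.Exports.
Local Open Scope classical_set_scope.
Local Open Scope ring_scope.

Definition stochastic (R : realType) (n : nat) (A : 'M[R]_n) : Prop :=
  (forall i j, 0 <= A i j) /\ (forall i, \sum_j A i j = 1).

Fixpoint walk (n : nat) (e : rel 'I_n) (k : nat) (i j : 'I_n) : bool :=
  if k is k'.+1 then [exists l, e i l && walk e k' l j] else i == j.

Definition strongly_connected (n : nat) (e : rel 'I_n) : Prop :=
  forall i j, exists k, walk e k i j.

Definition aperiodic (n : nat) (e : rel 'I_n) : Prop :=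
  forall d : nat, (forall i k, (0 < k)%N -> walk e k i i -> (d %| k)%N) -> d = 1%N.

Definition mx_graph (R : realType) (n : nat) (A : 'M[R]_n) : rel 'I_n :=
  fun i j => 0 < A i j.

Definition primitive (R : realType) (n : nat) (A : 'M[R]_n) : Prop :=
  strongly_connected (mx_graph A) /\ aperiodic (mx_graph A).

Definition mnorm1 (R : realType) (n : nat) (A : 'M[R]_n) : R :=
  \big[Num.max/0]_(j < n) \sum_(i < n) `|A i j|.

Definition vnorm_inf (R : realType) (n : nat) (v : 'rV[R]_n) : R :=
  \big[Num.max/0]_(i < n) `|v ord0 i|.

Definition ave (R : realType) (n : nat) (x : 'cV[R]_n) : R :=
  n%:R^-1 * \sum_(i < n) x i ord0.

Fixpoint traj (R : realType) (n : nat) (A : 'M[R]_n) (x0 : 'cV[R]_n) (k : nat)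
  : 'cV[R]_n :=
  if k is k'.+1 then A *m traj A x0 k' else x0.

Definition init_state (R : realType) (mu : R) (d : nat -> measure_display)
  (T : forall n, measurableType (d n)) (Pr : forall n, probability (T n) R)
  (xi : forall n, 'I_n -> {RV Pr n >-> R}) (n : nat) (w : T n) : 'cV[R]_n :=
  \col_i (mu + xi n i w).

Definition state (R : realType) (mu : R) (P : forall n, 'M[R]_n)
  (d : nat -> measure_display)
  (T : forall n, measurableType (d n)) (Pr : forall n, probability (T n) R)
  (xi : forall n, 'I_n -> {RV Pr n >-> R}) (n k : nat) (w : T n) : 'cV[R]_n :=
  traj (P n) (init_state mu xi w) k.
Arguments state {R} mu P {d T Pr} xi n k w.

Definition cvg_in_prob (R : realType) (d : nat -> measure_display)
  (T : forall n, measurableType (d n)) (Pr : forall n, probability (T n) R)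
  (Y : forall n, T n -> R) (c : R) : Prop :=
  forall eps : R, 0 < eps ->
    (fun n => Pr n [set w | eps <= `|Y n w - c|]) @ \oo --> 0%E.

(** For each n, xi n 0, ..., xi n (n-1) are independent N(0, sigma^2)
    random variables (sigma is the standard deviation). Independence of the
    finite family = product rule for preimages of any measurable sets. *)
Definition iid_gaussian (R : realType) (sigma : R) (d : nat -> measure_display)
  (T : forall n, measurableType (d n)) (Pr : forall n, probability (T n) R)
  (xi : forall n, 'I_n -> {RV Pr n >-> R}) : Prop :=
  forall n,
    (forall (i : 'I_n) (A : set R), measurable A ->
       distribution (Pr n) (xi n i) A = normal_prob 0 sigma A) /\
    (forall B : 'I_n -> set R, (forall i, measurable (B i)) ->
       Pr n (\bigcap_(i in [set: 'I_n]) (xi n i @^-1` B i))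
       = (\prod_(i < n) Pr n (xi n i @^-1` B i))%E).

Definition one_time_wise (R : realType) (mu : R) (P : forall n, 'M[R]_n)
  (d : nat -> measure_display)
  (T : forall n, measurableType (d n)) (Pr : forall n, probability (T n) R)
  (xi : forall n, 'I_n -> {RV Pr n >-> R}) : Prop :=
  cvg_in_prob Pr (fun n w => ave (state mu P xi n 1 w)) mu.

Definition finite_time_wise (R : realType) (mu : R) (P : forall n, 'M[R]_n)
  (d : nat -> measure_display)
  (T : forall n, measurableType (d n)) (Pr : forall n, probability (T n) R)
  (xi : forall n, 'I_n -> {RV Pr n >-> R}) : Prop :=
  forall k : nat, cvg_in_prob Pr (fun n w => ave (state mu P xi n k w)) mu.

Definition wise (R : realType) (mu : R) (P : forall n, 'M[R]_n)
  (d : nat -> measure_display)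
  (T : forall n, measurableType (d n)) (Pr : forall n, probability (T n) R)
  (xi : forall n, 'I_n -> {RV Pr n >-> R}) : Prop :=
  (forall n (w : T n), cvgn (fun k => ave (state mu P xi n k w))) /\
  cvg_in_prob Pr (fun n w => limn (fun k => ave (state mu P xi n k w))) mu.

(* Main.v *)
Require Import Defs.
From HB Require Import structures.
From mathcomp Require Import all_boot all_order all_algebra.
From mathcomp Require Import all_classical all_reals all_analysis.
From mathcomp Require Import measurable_realfun.
From mathcomp Require Import ring lra.
Set Implicit Arguments. Unset Strict Implicit. Unset Printing Implicit Defensive.
Import Order.TTheory GRing.Theory Num.Theory.
Import numFieldNormedType.Exports.
Local Open Scope classical_set_scope.
Local Open Scope ring_scope.

(** In each of the three cases the observable is [mu + S] with
    [S = \sum_i c_i xi_i] for nonnegative weights [c] of sum 1: the column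
    averages of [P ^+ k], or the dominant eigenvector. So everything reduces to:
    [S --> 0] in probability iff [max_i c_i --> 0].

    Both directions use that changing the sign of one [xi_j] preserves the joint
    law. If [S'] is [S] with [xi_j] replaced by [- xi_j], then
    [c_j xi_j = (S - S') / 2], so
    [Pr (|c_j xi_j| >= a) <= 2 Pr (|S| >= a)], which forces [c_j] to be small.
    Conversely [E S^2 = \sum_i c_i^2 E xi_i^2 <= max_i c_i * E xi^2], and
    Markov's inequality concludes.

    For (iii), primitivity makes some power [P ^+ m] entrywise positive; this
    power contracts the sup norm on the hyperplane [pi *m x = 0], so
    [P ^+ k *m x] converges to the constant vector [pi *m x]. *)

(** * Numerical semigroups and walks in strongly connected aperiodic graphs *)

(* The least positive difference [g] of two elements of [S] divides every
   element of [S], so [g = 1]: then [s] and [s + 1] lie in [S] for some [s], and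
   they generate every integer from [s * s] on. *)
Lemma numerical_semigroup_eventually (S : pred nat) (k0 : nat) :
  S 0%N -> (forall a b, S a -> S b -> S (a + b)%N) ->
  (0 < k0)%N -> S k0 -> (forall d, (forall k, S k -> (d %| k)%N) -> d = 1%N) ->
  exists N, forall k, (N <= k)%N -> S k.
Proof.
move=> S0 SD k0_gt0 Sk0 gcdS.
have SM q a : S a -> S (q * a)%N.
  by move=> Sa; elim: q => [//|q IH]; rewrite mulSn; exact: SD.
pose diff g := (0 < g)%N && `[< exists2 s, S s & S (s + g)%N >].
have exg : exists g, diff g.
  by exists k0; rewrite /diff k0_gt0; apply/asboolP; exists 0%N.
case: (ex_minnP exg) => g /andP[g_gt0 /asboolP[s Ss Ssg]] gmin.
have g1 : g = 1%N.
  apply: gcdS => k Sk; rewrite /dvdn.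
  apply: contraT; rewrite -lt0n => r_gt0.
  suff /gmin : diff (k %% g)%N by rewrite leqNgt ltn_mod g_gt0.
  (* With [q = k %/ g], both [q * (s + g)] and [k + q * s] lie in [S], and they differ by exactly
     [k %% g]. A nonzero remainder would thus be a difference smaller than [g]. *)
  rewrite /diff r_gt0; apply/asboolP; exists (k %/ g * (s + g))%N; first exact: SM.
  have -> : (k %/ g * (s + g) + k %% g = k + (k %/ g) * s)%N.
    by rewrite mulnDr -addnA -divn_eq addnC.
  by apply: SD => //; exact: SM.
exists (s * s)%N => k le_k.
case: (posnP s) => [s0|s_gt0].
  by rewrite -(muln1 k); apply: SM; rewrite -[1%N]add0n -{1}s0 -g1.
have lt_r := ltn_pmod k s_gt0.
(* Write [k = q * s + r] with [r < s]. Since [k >= s * s] gives [r <= q], [r] of the [q] copies of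
   [s] can be replaced by [s + 1]. *)
have le_q : (k %% s <= k %/ s)%N.
  by rewrite (leq_trans (ltnW lt_r))// leq_divRL.
have -> : k = ((k %/ s - k %% s) * s + (k %% s) * (s + g))%N.
  by rewrite g1 mulnBl mulnDr muln1 addnA subnK -?divn_eq// leq_mul2r le_q orbT.
by apply: SD; exact: SM.
Qed.

Lemma walkD n (e : rel 'I_n) a b i j l :
  walk e a i l -> walk e b l j -> walk e (a + b) i j.
Proof.
elim: a i => [|a IH] i /=; first by move/eqP->.
case/existsP=> m /andP[eim wml] wlj.
by apply/existsP; exists m; rewrite eim (IH m).
Qed.

(** The lengths of closed walks at a vertex form a semigroup, so all large lengths occur. A walk
    from [i] to [j] is then a closed walk at [i] that absorbs the surplus length, followed by a
    fixed connecting walk. *)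
Lemma walk_eventually n (e : rel 'I_n) :
  strongly_connected e -> aperiodic e ->
  exists m, forall i j, walk e m i j.
Proof.
move=> econ eaper.
have Hi i : exists N, forall k, (N <= k)%N -> walk e k i i.
  (* Aperiodicity concerns closed walks at all vertices. A closed walk of length [k] at [j] is
     transported to [i] by a detour: [d] divides [a + k + b] and [a + b], hence [k]. *)
  have Hd d : (forall k, walk e k i i -> (d %| k)%N) -> d = 1%N.
    move=> dP; apply: eaper => j k k_gt0 wk.
    have [a wa] := econ i j; have [b wb] := econ j i.
    have := dP _ (walkD (walkD wa wk) wb).
    rewrite addnAC dvdn_addr//; exact: dP (walkD wa wb).
  have [k [k_gt0 wk]] : exists k, (0 < k)%N /\ walk e k i i.
    apply: contrapT => nex.
    (* If the only closed walk had length 0, then [d = 0] would divide every length. *)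
    suff : 0%N = 1%N by [].
    apply: Hd => k wk; case: (posnP k) => [->//|k_gt0].
    by case: nex; exists k.
  apply: (@numerical_semigroup_eventually (fun k => walk e k i i) k) => //=.
  by move=> a b; exact: walkD.
have [N HN] := choice Hi.
have [a Ha] := choice (fun p : 'I_n * 'I_n => econ p.1 p.2).
(* Summing over all pairs makes the length uniform: removing [a (i, j)] still leaves at least
   [N i]. *)
exists (\sum_(p : 'I_n * 'I_n) (N p.1 + a p))%N => i j.
rewrite (bigD1 (i, j))//=.
set t := (X in (_ + _ + X)%N).
have -> : (N i + a (i, j) + t = (N i + t) + a (i, j))%N by rewrite addnAC.
by apply: walkD (Ha (i, j)); apply: HN; rewrite leq_addr.
Qed.

(** * Powers of stochastic matrices and convergence to consensus *)

Section Stochastic.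
Context {R : realType}.
Implicit Types n k : nat.

Lemma trajE n (A : 'M[R]_n) x k : traj A x k = A ^+ k *m x.
Proof.
elim: k => [|k IH]; first by rewrite expr0 mul1mx.
by rewrite /= IH mulmxA exprS.
Qed.

Lemma stochastic1 n : stochastic (1 : 'M[R]_n).
Proof.
split=> i => [j|]; first by rewrite mxE ler0n.
rewrite (bigD1 i)//= mxE eqxx big1 ?addr0// => j ij.
by rewrite mxE eq_sym (negbTE ij).
Qed.

Lemma stochasticM n (A B : 'M[R]_n) :
  stochastic A -> stochastic B -> stochastic (A *m B).
Proof.
move=> [A0 A1] [B0 B1]; split=> i => [j|].
  by rewrite mxE sumr_ge0// => l _; rewrite mulr_ge0.
under eq_bigr do rewrite mxE.
rewrite exchange_big/= -[RHS](A1 i); apply: eq_bigr => l _.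
by rewrite -mulr_sumr B1 mulr1.
Qed.

Lemma stochasticX n (A : 'M[R]_n) k : stochastic A -> stochastic (A ^+ k).
Proof.
move=> hA; elim: k => [|k IH]; first by rewrite expr0; exact: stochastic1.
by rewrite exprS; exact: stochasticM.
Qed.

Lemma walk_gt0 n (A : 'M[R]_n) k i j :
  stochastic A -> walk (mx_graph A) k i j -> 0 < (A ^+ k) i j.
Proof.
move=> hA; elim: k i => [|k IH] i /=.
  by move/eqP->; rewrite expr0 mxE eqxx ltr01.
case/existsP=> l /andP[Ail /IH Akl].
rewrite exprS mxE (bigD1 l)//= ltr_pwDl ?mulr_gt0//.
apply: sumr_ge0 => m _; rewrite mulr_ge0//; first by case: hA.
by have [] := stochasticX k hA.
Qed.

Lemma primitive_power_gt0 n (A : 'M[R]_n) : stochastic A -> primitive A ->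
  exists m, forall i j, 0 < (A ^+ m) i j.
Proof.
move=> hA [hcon haper]; have [m Hm] := walk_eventually hcon haper.
by exists m => i j; exact: walk_gt0.
Qed.

Lemma stochastic_sup_le n (A : 'M[R]_n) (x : 'cV[R]_n) C :
  stochastic A -> (forall i, `|x i ord0| <= C) ->
  forall i, `|(A *m x) i ord0| <= C.
Proof.
move=> [A0 A1] xC i; rewrite mxE (le_trans (ler_norm_sum _ _ _))//.
rewrite -[C]mul1r -(A1 i) mulr_suml; apply: ler_sum => j _.
by rewrite normrM ger0_norm// ler_wpM2l.
Qed.

(* On the hyperplane [pi *m x = 0] the matrix [A] acts as [A - delta 1 pi],
   which is nonnegative with row sums [1 - delta]. *)
Lemma stochastic_contraction n (A : 'M[R]_n) (pi : 'rV[R]_n) delta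
    (x : 'cV[R]_n) C :
  stochastic A -> \sum_j pi ord0 j = 1 ->
  (forall i j, delta * pi ord0 j <= A i j) ->
  pi *m x = 0 -> (forall i, `|x i ord0| <= C) ->
  forall i, `|(A *m x) i ord0| <= (1 - delta) * C.
Proof.
move=> [A0 A1] pi1 dA pix xC i.
have -> : (A *m x) i ord0 = \sum_j (A i j - delta * pi ord0 j) * x j ord0.
  under eq_bigr do rewrite mulrBl.
  rewrite sumrB mxE; under [X in _ - X]eq_bigr do rewrite -mulrA.
  rewrite -mulr_sumr.
  have -> : \sum_j pi ord0 j * x j ord0 = (pi *m x) ord0 ord0 by rewrite mxE.
  by rewrite pix mxE mulr0 subr0.
have -> : 1 - delta = \sum_j (A i j - delta * pi ord0 j).
  by rewrite sumrB A1 -mulr_sumr pi1 mulr1.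
rewrite (le_trans (ler_norm_sum _ _ _))// mulr_suml; apply: ler_sum => j _.
have d0 : 0 <= A i j - delta * pi ord0 j by rewrite subr_ge0.
by rewrite normrM (ger0_norm d0) ler_wpM2l.
Qed.

Lemma mulmx_powl n (A : 'M[R]_n) (pi : 'rV[R]_n) k :
  pi *m A = pi -> pi *m A ^+ k = pi.
Proof.
move=> piA; elim: k => [|k IH]; first by rewrite expr0 mulmx1.
by rewrite exprS mulmxA piA.
Qed.

(** Each factor [A ^+ m] shrinks the sup norm by [1 - delta] and keeps the vector in the hyperplane,
    because [pi] is invariant. The remaining [k - m * N] factors do not increase the norm. *)
Lemma primitive_power_cvg0 n (A : 'M[R]_n) (pi : 'rV[R]_n) (x : 'cV[R]_n) i :
  stochastic A -> primitive A ->
  (forall i, 0 <= pi ord0 i) -> \sum_i pi ord0 i = 1 -> pi *m A = pi ->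
  pi *m x = 0 -> (fun k => (A ^+ k *m x) i ord0) @ \oo --> 0.
Proof.
move=> hA pA pi0 pi1 piA pix.
have [m Am] := primitive_power_gt0 hA pA.
have [C C0 xC] : exists2 C, 0 <= C & forall i, `|x i ord0| <= C.
  exists (\sum_i `|x i ord0|); first exact: sumr_ge0.
  by move=> j; rewrite (bigD1 j)//= lerDl sumr_ge0.
have [delta /andP[d0 d1] dA] : exists2 delta, 0 < delta <= 1 &
    forall i j, delta <= (A ^+ m) i j.
  (* The default value 1 of the minimum gives [delta <= 1], so that [1 - delta] is a nonnegative
     ratio. *)
  exists (\big[Num.min/1]_(p : 'I_n * 'I_n) (A ^+ m) p.1 p.2).
    by apply/andP; split; [apply/bigmin_gtP|exact: bigmin_le_id].
  by move=> a b; rewrite (bigmin_le_cond _ (j:=(a, b))).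
have step q j : `|((A ^+ m) ^+ q *m x) j ord0| <= (1 - delta) ^+ q * C.
  elim: q j => [|q IH] j; first by rewrite expr0 mul1mx mul1r.
  rewrite exprS [(_ * _)%R in X in `|X|]/GRing.mul/= -mulmxA exprS -mulrA.
  apply: (@stochastic_contraction _ _ pi) => //; first exact: stochasticX.
    move=> a b; apply: le_trans (dA a b); rewrite ler_piMr ?(ltW d0)//.
    by rewrite -pi1 (bigD1 b)//= lerDl sumr_ge0.
  by rewrite mulmxA !mulmx_powl// mulmx_powl.
apply/cvgrPdist_le => eps eps0.
have : (fun q => (1 - delta) ^+ q * C) @ \oo --> 0 * C.
  by apply: cvgMl; apply: cvg_expr; rewrite ger0_norm ?subr_ge0//; lra.
rewrite mul0r => /cvgrPdist_le /(_ _ eps0) [N _ HN].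
exists (m * N)%N => //= k /= lek.
rewrite sub0r normrN -(subnK lek) exprD [(_ * _)%R in X in `|X|]/GRing.mul/= -mulmxA.
apply: stochastic_sup_le; first exact: stochasticX.
move=> j; rewrite exprM (le_trans (step _ _))//.
have /= := HN N (leqnn N); rewrite sub0r normrN; exact: le_trans (ler_norm _).
Qed.

(** Subtracting the constant vector of value [pi *m x] from [x] lands in the hyperplane, and
    constant vectors are fixed by every power of [A]. *)
Lemma primitive_power_cvg n (A : 'M[R]_n) (pi : 'rV[R]_n) (x : 'cV[R]_n) i :
  stochastic A -> primitive A ->
  (forall i, 0 <= pi ord0 i) -> \sum_i pi ord0 i = 1 -> pi *m A = pi ->
  (fun k => (A ^+ k *m x) i ord0) @ \oo --> (pi *m x) ord0 ord0.
Proof.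
move=> hA pA pi0 pi1 piA; set a := (pi *m x) ord0 ord0.
have Ac k : A ^+ k *m const_mx a = const_mx a :> 'cV_n.
  apply/colP => j; rewrite !mxE.
  have [_ A1] := stochasticX k hA.
  under eq_bigr do rewrite mxE.
  by rewrite -mulr_suml A1 mul1r.
have : (fun k => (A ^+ k *m (x - const_mx a)) i ord0) @ \oo --> 0.
  apply: (primitive_power_cvg0 i hA pA pi0 pi1 piA).
  rewrite mulmxBr; apply/rowP => j; rewrite (ord1 j) !mxE.
  under [X in _ - X]eq_bigr do rewrite mxE.
  by rewrite -mulr_suml pi1 mul1r /a mxE subrr.
move=> /cvgD /(_ (cvg_cst a)); rewrite add0r; apply: cvg_trans.
apply: near_eq_cvg; apply: nearW => k /=.
by rewrite fctE mulmxBr Ac !mxE subrK.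
Qed.

End Stochastic.

(** * The centred normal law: symmetry, finite second moment, positive tail *)

Lemma measurable_abs_ge d (T : measurableType d) (R : realType) (f : T -> R)
    (a : R) :
  measurable_fun setT f -> measurable [set t | a <= `|f t|].
Proof.
move=> mf; rewrite -[X in measurable X]setTI; apply: measurable_fun_le => //.
exact: measurableT_comp.
Qed.

(** The density is even and Lebesgue measure is invariant under reflection. *)
Lemma normal_prob_opp (R : realType) (s : R) (A : set R) : s != 0 -> measurable A ->
  normal_prob 0 s (-%R @^-1` A) = normal_prob 0 s A.
Proof.
move=> s0 mA; rewrite /normal_prob.
pose f (x : R) := (normal_pdf 0 s x)%:E.
have mf : measurable_fun [set: R] f.
  by apply/measurable_EFinP; exact: measurable_normal_pdf.
have f0 (x : R) : (0 <= f x)%E by rewrite lee_fin normal_pdf_ge0.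
transitivity (\int[lebesgue_measure]_(x in (-%R : R -> measurableTypeR R) @^-1` A)
   (f \o -%R) x)%E.
  apply: eq_integral => x _; congr EFin.
  by rewrite normal_pdfE// /normal_fun !subr0 sqrrN.
rewrite -ge0_integral_pushforward//=; last exact: measurable_funTS.
by apply: eq_measure_integral => //= B mB _; exact: lebesgue_measureN.
Qed.

Section NormalIntegral.
Context {R : realType}.
Local Notation mu := (@lebesgue_measure R).
Implicit Types (m s : R).

(** The Radon-Nikodym derivative of the normal law and [normal_pdf] have the same integral over
    every measurable set, so they agree almost everywhere. *)
Lemma ge0_integral_normal_prob m s (f : R -> \bar R) :
  measurable_fun [set: R] f -> (forall x, 0 <= f x)%E ->
  (\int[normal_prob m s]_x f x = \int[mu]_x (f x * (normal_pdf m s x)%:E))%E.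
Proof.
move=> mf f0.
have dom := normal_prob_dominates m s.
rewrite -(Radon_Nikodym_SigmaFinite.change_of_variables dom)//.
have rnI := Radon_Nikodym_SigmaFinite.f_integrable dom.
have mpdf : measurable_fun [set: R] (fun x => (normal_pdf m s x)%:E).
  by apply/measurable_EFinP; exact: measurable_normal_pdf.
apply: ae_eq_integral => //.
- by apply: emeasurable_funM => //; exact: (measurable_int mu).
- exact: emeasurable_funM.
- apply: ae_eqe_mul2l; apply: integral_ae_eq => // E _ mE.
  by rewrite -Radon_Nikodym_SigmaFinite.f_integral.
Qed.

Lemma normal_second_moment_lty s : s != 0 ->
  (\int[normal_prob 0 s]_x (x ^+ 2)%:E < +oo)%E.
Proof.
move=> s0.
have msq : measurable_fun [set: R] (fun x : R => (x ^+ 2)%:E).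
  by apply/measurable_EFinP; exact: (measurable_funX 2 (@measurable_id _ R setT)).
rewrite (ge0_integral_normal_prob _ _ msq); last by move=> x; rewrite lee_fin sqr_ge0.
(* Multiplying the deviation by the square root of 2 halves the exponent, leaving a spare factor
   [expR (- u)] with [x ^+ 2 = 4 * s ^+ 2 * u]. The constant [C] collects [4 * s ^+ 2] and the ratio
   of the two peaks. *)
pose s2 := s * Num.sqrt 2.
have s20 : s2 != 0 by rewrite mulf_neq0// sqrtr_eq0 -ltNge.
pose C := 4 * s ^+ 2 * normal_peak s / normal_peak s2.
have pk0 := normal_peak_gt0 s0; have pk20 := normal_peak_gt0 s20.
have C0 : 0 <= C.
  by rewrite /C divr_ge0 ?(ltW pk20)// mulr_ge0 ?(ltW pk0)// mulr_ge0// sqr_ge0.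
have mpdf t : measurable_fun [set: R] (fun x => (normal_pdf 0 t x)%:E).
  by apply/measurable_EFinP; exact: measurable_normal_pdf.
apply: (@le_lt_trans _ _ (\int[mu]_x (C%:E * (normal_pdf 0 s2 x)%:E))%E).
  apply: ge0_le_integral => //.
  - by move=> x _; rewrite mule_ge0// lee_fin ?sqr_ge0 ?normal_pdf_ge0.
  - by apply: emeasurable_funM => //; exact: mpdf.
  - by apply: measurable_funeM; exact: mpdf.
  - move=> x _; rewrite -!EFinM lee_fin !normal_pdfE// /normal_fun !subr0.
    have s4 : s ^+ 2 * 4 != 0 by rewrite mulf_neq0// expf_neq0.
    pose u := x ^+ 2 / (s ^+ 2 * 4).
    have -> : - x ^+ 2 / (s ^+ 2 *+ 2) = - u - u.
      by rewrite /u -mulr_natr; field.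
    have -> : - x ^+ 2 / (s2 ^+ 2 *+ 2) = - u.
      rewrite /s2 exprMn sqr_sqrtr// /u -mulr_natr; field.
      by rewrite s0.
    (* [u * expR (- u) <= 1] trades the factor [x ^+ 2] for a normal density of
       standard deviation [s2]. *)
    have -> : x ^+ 2 = 4 * s ^+ 2 * u by rewrite /u; field.
    rewrite expRD.
    have -> : C * (normal_peak s2 * expR (- u)) = 4 * s ^+ 2 * normal_peak s * expR (- u).
      by rewrite /C; field; rewrite gt_eqF.
    have -> : 4 * s ^+ 2 * u * (normal_peak s * (expR (- u) * expR (- u))) =
       (4 * s ^+ 2 * normal_peak s * expR (- u)) * (u * expR (- u)) by ring.
    rewrite ler_piMr//.
      by apply: mulr_ge0 (expR_ge0 _); apply: mulr_ge0 (ltW pk0); rewrite mulr_ge0// sqr_ge0.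
    rewrite expRN ler_pdivrMr ?expR_gt0// mul1r.
    by rewrite (le_trans _ (expR_ge1Dx _))// lerDr.
rewrite ge0_integralZl//; last 2 first.
- exact: mpdf.
- by move=> x _; rewrite lee_fin normal_pdf_ge0.
by rewrite integral_normal_pdf mule1 ltry.
Qed.

(** On the interval from 1 to 2 the density is at least its value at 2, which is positive. *)
Lemma normal_prob_tail_gt0 s : s != 0 ->
  (0 < normal_prob 0 s [set x | 1 <= `|x|]%R)%E.
Proof.
move=> s0; rewrite /normal_prob.
have mpdf : measurable_fun [set: R] (fun x => (normal_pdf 0 s x)%:E).
  by apply/measurable_EFinP; exact: measurable_normal_pdf.
have mT : measurable [set x : R | 1 <= `|x|].
  exact: (measurable_abs_ge 1 (@measurable_id _ R setT)).
apply: (@lt_le_trans _ _ (\int[mu]_(x in `[1%R, 2%R]) (normal_pdf 0 s 2)%:E)%E).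
  rewrite integral_cst//= lebesgue_measure_itv/= lte_fin ltr1n -EFinD -EFinM lte_fin.
  rewrite mulr_gt0//.
  by rewrite normal_pdfE// mulr_gt0 ?normal_peak_gt0 ?expR_gt0.
apply: (@le_trans _ _ (\int[mu]_(x in `[1%R, 2%R]) (normal_pdf 0 s x)%:E)%E).
  apply: ge0_le_integral => //=.
  - by move=> x _; rewrite lee_fin normal_pdf_ge0.
  - exact: measurable_funTS.
  - move=> x; rewrite in_itv/= => /andP[x1 x2].
    rewrite lee_fin !normal_pdfE// ler_pM2l ?normal_peak_gt0// ler_expR !subr0.
    rewrite !mulNr lerN2 ler_pM2r; last first.
      by rewrite invr_gt0 -mulr_natr mulr_gt0// exprn_even_gt0.
    by rewrite ler_sqr// nnegrE; lra.
apply: ge0_subset_integral => //=.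
- exact: measurable_funTS.
- by move=> x _; rewrite lee_fin normal_pdf_ge0.
- move=> x /=; rewrite in_itv/= => /andP[x1 x2].
  by rewrite (le_trans x1)// ler_norm.
Qed.

End NormalIntegral.

(** * Linear combinations of independent symmetric variables *)

Section IndependentSymmetric.
Context {R : realType} {d : measure_display} {T : measurableType d}.
Context {Pr : probability T R} {n : nat} (xi : 'I_n -> {RV Pr >-> R}).
Hypothesis xi_sym : forall i (A : set R), measurable A ->
  Pr (xi i @^-1` (-%R @^-1` A)) = Pr (xi i @^-1` A).
Hypothesis xi_indep : forall B : 'I_n -> set R, (forall i, measurable (B i)) ->
  Pr (\bigcap_(i in [set: 'I_n]) (xi i @^-1` B i))
  = (\prod_(i < n) Pr (xi i @^-1` B i))%E.

Definition lin_comb (w : 'I_n -> R) (t : T) : R := \sum_i w i * xi i t.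

(** The sign change of [xi j] is carried by the weight, so that the modified sum is again a
    [lin_comb] of the same variables. *)
Definition flip (j : 'I_n) (w : 'I_n -> R) (i : 'I_n) : R :=
  if i == j then - w i else w i.

Lemma measurable_lin_comb w : measurable_fun setT (lin_comb w).
Proof. by apply: measurable_sum => i; exact: measurable_funM. Qed.

(** Measurable rectangles: a family closed under intersection that generates the product
    sigma-algebra, on which independence determines the joint law. *)
Let boxes : set (set (n.-tuple R)) := [set E | exists2 B : 'I_n -> set R,
  (forall i, measurable (B i)) & E = [set x | forall i, B i (tnth x i)]].

Let measurable_boxes : measurable = <<s boxes >>.
Proof.
rewrite eqEsubset; split; apply: smallest_sub.
- exact: smallest_sigma_algebra.
- move=> E; rewrite -bigcup_seq => -[i _ [B mB <-]].
  apply: sub_sigma_algebra; exists (fun k => if k == i then B else setT).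
    by move=> k; case: ifP.
  rewrite setTI; apply/seteqP; split => x /=.
    by move=> Bx k; case: eqP => [->|].
  by move/(_ i); rewrite eqxx.
- exact: sigma_algebra_measurable.
- move=> _ [B mB ->].
  rewrite (_ : [set x | _] = \bigcap_(i in [set: 'I_n]) ((@tnth _ R ^~ i) @^-1` B i)).
    apply: fin_bigcap_measurable => // i _.
    rewrite -[X in measurable X]setTI; exact: measurable_tnth.
  by apply/seteqP; split => x h i; [move=> _; exact: h|exact: (h i I)].
Qed.

(** The tuple of the [xi i] and the tuple with [xi j] negated have the same probability on every
    box, by independence and the symmetry of [xi j]. Uniqueness of measures extends this to all
    measurable sets of tuples. *)
Lemma law_flip j w (A : set R) : measurable A ->
  Pr (lin_comb w @^-1` A) = Pr (lin_comb (flip j w) @^-1` A).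
Proof.
move=> mA.
pose X (t : T) := [tuple xi i t | i < n].
pose Y (t : T) := [tuple (if i == j then - xi i t else xi i t) | i < n].
have mX : measurable_fun setT X.
  apply/measurable_fun_tnthP => i; rewrite (_ : _ \o _ = xi i)//.
  by apply/funext => t; rewrite /= tnth_mktuple.
have mY : measurable_fun setT Y.
  apply/measurable_fun_tnthP => i.
  rewrite (_ : _ \o _ = fun t => if i == j then - xi i t else xi i t).
    by case: eqP => _ //; exact: measurableT_comp.
  by apply/funext => t; rewrite /= tnth_mktuple.
pose XM : {mfun T >-> n.-tuple R} := HB.pack X (isMeasurableFun.Build _ _ _ _ X mX).
pose YM : {mfun T >-> n.-tuple R} := HB.pack Y (isMeasurableFun.Build _ _ _ _ Y mY).
have XY E : measurable E -> distribution Pr XM E = distribution Pr YM E.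
  apply: (measure_unique boxes (fun=> setT)) => //.
  - move=> _ _ [B mB ->] [C mC ->]; exists (fun i => B i `&` C i).
      by move=> i; exact: measurableI.
    apply/seteqP; split => x /=; first by move=> [? ?] i; split.
    by move=> h; split=> i; have [] := h i.
  - move=> _; exists (fun=> setT) => //.
    by apply/seteqP; split.
  - by rewrite bigcup_const.
  - move=> _ [B mB ->]; rewrite /distribution /pushforward /=.
    pose B' i := if i == j then -%R @^-1` B i else B i.
    have mN (C : set R) : measurable C -> measurable (-%R @^-1` C).
      by move=> mC; rewrite -[X in measurable X]setTI; exact: oppr_measurable.
    transitivity (Pr (\bigcap_(i in [set: 'I_n]) (xi i @^-1` B i))).
      congr (Pr _); apply/seteqP; split => t /= h i; first by move=> _; have := h i; rewrite tnth_mktuple.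
      by rewrite tnth_mktuple; exact: h.
    transitivity (Pr (\bigcap_(i in [set: 'I_n]) (xi i @^-1` B' i))).
      rewrite !xi_indep//; last by move=> i; rewrite /B'; case: eqP => // _; exact: mN.
      by apply: eq_bigr => i _; rewrite /B'; case: eqP => // _; rewrite xi_sym.
    congr (Pr _); apply/seteqP; split => t /= h i.
      by have := h i I; rewrite tnth_mktuple /B'; case: eqP.
    by move=> _; have := h i; rewrite tnth_mktuple /B'; case: eqP.
  - by move=> k; rewrite -ge0_fin_numE// fin_num_measure.
(* The event on the weighted sum is pulled back to tuples; in the second tuple the sign of the
   [j]-th entry moves onto its weight. *)
pose E := [set x : n.-tuple R | A (\sum_i w i * tnth x i)].
have mE : measurable E.
  have mS : measurable_fun setT (fun x : n.-tuple R => \sum_i w i * tnth x i).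
    apply: measurable_sum => i; apply: measurable_funM => //; exact: measurable_tnth.
  by rewrite -[E]setTI; exact: mS.
have := XY _ mE; rewrite /distribution /pushforward /= => h.
transitivity (Pr (X @^-1` E)).
  have e t : \sum_i w i * tnth (X t) i = lin_comb w t.
    by apply: eq_bigr => i _; rewrite tnth_mktuple.
  by congr (Pr _); apply/seteqP; split => t /=; rewrite /E/= e.
rewrite h; congr (Pr _).
have e t : \sum_i w i * tnth (Y t) i = lin_comb (flip j w) t.
  apply: eq_bigr => i _; rewrite tnth_mktuple /flip.
  by case: eqP => // _; rewrite mulrN mulNr.
by apply/seteqP; split => t /=; rewrite /E/= e.
Qed.

Lemma ge0_integral_flip j w (f : R -> \bar R) :
  measurable_fun [set: R] f -> (forall x, 0 <= f x)%E ->
  (\int[Pr]_t f (lin_comb w t) = \int[Pr]_t f (lin_comb (flip j w) t))%E.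
Proof.
move=> mf f0.
rewrite -[LHS](ge0_integral_pushforward (measurable_lin_comb w) Pr measurableT mf)//.
rewrite -[RHS](ge0_integral_pushforward (measurable_lin_comb (flip j w)) Pr
  measurableT mf)//.
apply: eq_measure_integral; [exact: measurable_lin_comb..|move=> ? ? A mA _].
exact: law_flip.
Qed.

(* The law of [A + B] is that of [- A + B], so the parallelogram law gives
   [E (A + B)^2 = E A^2 + E B^2]; no integrability is needed. *)
Lemma second_moment_sum (s : seq 'I_n) w : uniq s ->
  (\int[Pr]_t ((\sum_(i <- s) w i * xi i t) ^+ 2)%:E =
   \sum_(i <- s) (w i ^+ 2)%:E * \int[Pr]_t (xi i t ^+ 2)%:E)%E.
Proof.
elim: s => [_|j s IH /= /andP[js us]].
  by rewrite big_nil integral0_eq// => t _; rewrite big_nil expr0n.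
rewrite big_cons -(IH us).
have msq (f : T -> R) : measurable_fun setT f ->
    measurable_fun setT (fun t => (f t ^+ 2)%:E).
  by move=> mf; apply/measurable_EFinP; exact: measurable_funX.
pose A t := w j * xi j t; pose B t := \sum_(i <- s) w i * xi i t.
have mA : measurable_fun setT A by exact: measurable_funM.
have mB : measurable_fun setT B.
  by apply: measurable_sum => i; exact: measurable_funM.
have mAB : measurable_fun setT (fun t => A t + B t) by exact: measurable_funD.
have mNAB : measurable_fun setT (fun t => - A t + B t).
  by apply: measurable_funD => //; exact: measurableT_comp.
(* Setting the weights outside [j :: s] to zero turns the partial sum into a full [lin_comb], to
   which the flip applies. *)
pose w' i := if i \in j :: s then w i else 0.
have w'j : w' j = w j by rewrite /w' mem_head.
have w's t : \sum_(i | i != j) w' i * xi i t = B t.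
  rewrite /B big_uniq// big_mkcond [RHS]big_mkcond/=; apply: eq_bigr => i _.
  rewrite /w' inE; have [->|ij] := eqVneq i j; first by rewrite (negbTE js).
  by case: (i \in s); rewrite ?mul0r.
have SAB t : lin_comb w' t = A t + B t.
  by rewrite /lin_comb (bigD1 j)//= w'j w's.
have SNAB t : lin_comb (flip j w') t = - A t + B t.
  rewrite /lin_comb (bigD1 j)//= /flip eqxx w'j mulNr; congr (_ + _).
  by rewrite -w's; apply: eq_bigr => i /negbTE ->.
have msqid : measurable_fun [set: R] (fun x : R => (x ^+ 2)%:E).
  by apply/measurable_EFinP; exact: (measurable_funX 2 (@measurable_id _ R setT)).
have flipAB : (\int[Pr]_t ((A t + B t) ^+ 2)%:E =
    \int[Pr]_t ((- A t + B t) ^+ 2)%:E)%E.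
  under eq_integral do rewrite -SAB.
  under [RHS]eq_integral do rewrite -SNAB.
  apply: (ge0_integral_flip j w' msqid) => x.
  by rewrite lee_fin sqr_ge0.
transitivity (\int[Pr]_t ((A t + B t) ^+ 2)%:E)%E.
  by apply: eq_integral => t _; rewrite big_cons.
transitivity (\int[Pr]_t ((A t ^+ 2)%:E + (B t ^+ 2)%:E))%E; last first.
  rewrite ge0_integralD//; last 4 first.
  - by move=> t _; rewrite lee_fin sqr_ge0.
  - exact: msq.
  - by move=> t _; rewrite lee_fin sqr_ge0.
  - exact: msq.
  congr (_ + _)%E; rewrite -ge0_integralZl//; last 3 first.
  - exact: msq.
  - by move=> t _; rewrite lee_fin sqr_ge0.
  - by rewrite lee_fin sqr_ge0.
  by apply: eq_integral => t _; rewrite -EFinM /A exprMn.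
have half x : (0 <= x -> x = 2^-1%:E * x + 2^-1%:E * x :> \bar R)%E.
  move=> x0; rewrite -ge0_muleDl ?lee_fin ?invr_ge0// -EFinD.
  by rewrite (_ : 2^-1 + 2^-1 = 1 :> R)%R ?mul1e//; field.
(* Only one of the two halves is flipped; their sum is then the integral of the mean of the squares
   of [A + B] and [- A + B], where the cross terms cancel. *)
rewrite [LHS]half; last by apply: integral_ge0 => t _; rewrite lee_fin sqr_ge0.
rewrite {2}flipAB -!ge0_integralZl ?lee_fin ?invr_ge0//; last 4 first.
- exact: msq.
- by move=> t _; rewrite lee_fin sqr_ge0.
- exact: msq.
- by move=> t _; rewrite lee_fin sqr_ge0.
rewrite -ge0_integralD//; last 4 first.
- by move=> t _; rewrite -EFinM lee_fin mulr_ge0 ?invr_ge0 ?sqr_ge0.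
- by apply: measurable_funeM; exact: msq.
- by move=> t _; rewrite -EFinM lee_fin mulr_ge0 ?invr_ge0 ?sqr_ge0.
- by apply: measurable_funeM; exact: msq.
apply: eq_integral => t _; rewrite -!EFinM -!EFinD; congr EFin.
by field.
Qed.

Lemma second_moment_lin_comb w :
  (\int[Pr]_t (lin_comb w t ^+ 2)%:E =
   \sum_i (w i ^+ 2)%:E * \int[Pr]_t (xi i t ^+ 2)%:E)%E.
Proof. exact/second_moment_sum/index_enum_uniq. Qed.

Lemma coordinate_tail_le j w (a : R) :
  (Pr [set t | a <= `|w j * xi j t|]%R
   <= Pr [set t | a <= `|lin_comb w t|]%R + Pr [set t | a <= `|lin_comb w t|]%R)%E.
Proof.
have mS v := measurable_abs_ge a (measurable_lin_comb v).
have flipE : Pr [set t | a <= `|lin_comb w t|] =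
    Pr [set t | a <= `|lin_comb (flip j w) t|].
  apply: (law_flip j w (A := [set x | a <= `|x|])).
  exact: (measurable_abs_ge a (@measurable_id _ R setT)).
rewrite [X in (_ <= _ + X)%E]flipE.
apply: le_trans (measureU2 _ (mS _) (mS _)); last first.
apply: le_measure; rewrite ?inE.
- by apply: measurable_abs_ge; exact: measurable_funM.
- exact: measurableU.
move=> t /= aw.
have [?|ltS] := leP a `|lin_comb w t|; first by left.
have [?|ltF] := leP a `|lin_comb (flip j w) t|; first by right.
have : lin_comb w t - lin_comb (flip j w) t = (w j * xi j t) * 2.
  rewrite /lin_comb -sumrB (bigD1 j)//= /flip eqxx big1 ?addr0; first by ring.
  by move=> i /negbTE ->; rewrite subrr.
move=> /(congr1 Num.norm); rewrite normrM (ger0_norm (ler0n _ 2)) => e.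
have := ler_normB (lin_comb w t) (lin_comb (flip j w) t).
by rewrite e => h; clear flipE; lra.
Qed.

End IndependentSymmetric.

(** * Weighted means of Gaussian variables concentrate iff the largest weight vanishes *)

Section WeightedMean.
Context {R : realType} (mu sigma : R) {d : nat -> measure_display}.
Context {T : forall n, measurableType (d n)} {Pr : forall n, probability (T n) R}.
Context (xi : forall n, 'I_n -> {RV Pr n >-> R}).
Arguments xi : clear implicits.
Hypothesis sigma_gt0 : 0 < sigma.
Hypothesis hxi : iid_gaussian sigma xi.

Let sigma0 : sigma != 0. Proof. by rewrite gt_eqF. Qed.

Lemma gaussian_sym n (i : 'I_n) (A : set R) : measurable A ->
  Pr n (xi n i @^-1` (-%R @^-1` A)) = Pr n (xi n i @^-1` A).
Proof.
move=> mA; have [law _] := hxi n.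
have mNA : measurable (-%R @^-1` A).
  by rewrite -[X in measurable X]setTI; exact: oppr_measurable.
transitivity (distribution (Pr n) (xi n i) (-%R @^-1` A)); first by [].
transitivity (distribution (Pr n) (xi n i) A); last by [].
by rewrite !law//; exact: normal_prob_opp.
Qed.

Lemma gaussian_second_moment n (i : 'I_n) :
  (\int[Pr n]_t (xi n i t ^+ 2)%:E = \int[normal_prob 0 sigma]_x (x ^+ 2)%:E)%E.
Proof.
have [law _] := hxi n.
have msq : measurable_fun [set: R] (fun x : R => (x ^+ 2)%:E).
  by apply/measurable_EFinP; exact: (measurable_funX 2 (@measurable_id _ R setT)).
rewrite -[LHS](@ge0_integral_distribution _ _ _ _ _ _ (xi n i) _ msq); last first.
  by move=> x; rewrite lee_fin sqr_ge0.
(* [normal_prob] lives on [measurableTypeR R] and [distribution] on [R]; these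
   have the same measurable sets but are different structures. *)
have mid : measurable_fun setT (idfun : measurableTypeR R -> R).
  by move=> _ A mA; rewrite setTI.
rewrite -[RHS](ge0_integral_pushforward mid (normal_prob 0 sigma) measurableT msq).
  by apply: eq_measure_integral => ? ? ?; exact: law.
by move=> x _; rewrite lee_fin sqr_ge0.
Qed.

Lemma chebyshev_lin_comb n (c : 'I_n -> R) (M m eps : R) :
  0 < eps -> (forall i, 0 <= c i) -> \sum_i c i = 1 ->
  (forall i, c i <= m) ->
  (\int[normal_prob 0 sigma]_x (x ^+ 2)%:E)%E = M%:E ->
  (Pr n [set t | eps <= `|lin_comb (xi n) c t|]%R <= (eps ^- 2 * (m * M))%:E)%E.
Proof.
move=> eps0 c0 c1 cm EM.
have [_ indep] := hxi n.
have M0 : 0 <= M.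
  by rewrite -lee_fin -EM integral_ge0// => x _; rewrite lee_fin sqr_ge0.
have secm : (\int[Pr n]_t (lin_comb (xi n) c t ^+ 2)%:E <= (m * M)%:E)%E.
  rewrite (second_moment_lin_comb (@gaussian_sym n) indep).
  under eq_bigr do rewrite gaussian_second_moment EM -EFinM.
  rewrite sumEFin lee_fin -mulr_suml ler_wpM2r//.
  (* Termwise, [c i ^+ 2 <= m * c i], and the weights sum to 1. *)
  rewrite -[m]mulr1 -c1 mulr_sumr; apply: ler_sum => i _.
  by rewrite expr2 ler_wpM2r.
have mS := measurable_lin_comb (xi n) c.
have eps2 : 0 < eps ^+ 2 by rewrite exprn_gt0.
rewrite EFinM -lee_pdivrMl ?invr_gt0// invrK.
apply: le_trans secm.
have mE := measurable_abs_ge eps mS.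
(* Markov's inequality: [eps ^+ 2] times the indicator of the event is at most the square of the
   combination. *)
rewrite -[X in Pr n X]setIT -integral_indic// -ge0_integralZl//; last 2 first.
- by apply/measurable_EFinP; exact: measurable_indic.
- by rewrite lee_fin ltW.
apply: ge0_le_integral => //.
- by move=> t _; rewrite -EFinM lee_fin mulr_ge0// ltW.
- by apply: measurable_funeM; apply/measurable_EFinP; exact: measurable_indic.
- by apply/measurable_EFinP; exact: measurable_funX.
move=> t _; rewrite -EFinM lee_fin indicE.
have [/set_mem/= h|_] := boolP (t \in _); last by rewrite mulr0 sqr_ge0.
by rewrite mulr1 -[leRHS]real_normK ?num_real// ler_sqr ?nnegrE// ltW.
Qed.

(** The guards [0 < n] reflect that an empty family of weights cannot sum to 1; limits in [n] ignore
    the case [n = 0]. *)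
Lemma weighted_mean_cvg (c : forall n, 'I_n -> R) (Y : forall n, T n -> R) :
  (forall n i, 0 <= c n i) -> (forall n, (0 < n)%N -> \sum_i c n i = 1) ->
  (forall n t, (0 < n)%N -> Y n t = mu + lin_comb (xi n) (c n) t) ->
  cvg_in_prob Pr Y mu <->
  (fun n => \big[Num.max/0]_(i < n) c n i) @ \oo --> 0.
Proof.
move=> c0 c1 YE.
have YS n : (0 < n)%N -> forall eps, [set t | eps <= `|Y n t - mu|] =
    [set t | eps <= `|lin_comb (xi n) (c n) t|].
  move=> n0 eps; apply/seteqP; split => t /=; rewrite YE//;
    by rewrite (_ : mu + _ - mu = lin_comb (xi n) (c n) t)// addrAC subrr add0r.
split=> [YC|cC eps eps0].
- apply/cvgrPdist_le => delta delta0.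
  have [q q0 tailE] : exists2 q : R, 0 < q &
      normal_prob 0 sigma [set x | 1 <= `|x|] = q%:E.
    have := normal_prob_tail_gt0 sigma0.
    have : normal_prob 0 sigma [set x : R | 1 <= `|x|] \is a fin_num.
      apply: fin_num_measure.
      exact: (measurable_abs_ge 1 (@measurable_id _ R setT)).
    by case: (normal_prob _ _ _) => // q _; rewrite lte_fin => q0; exists q.
  (* A weight above [delta] would give [c n i * xi n i] a tail at [delta] of probability at least
     [q]. Sign flipping bounds that tail by twice the tail of the sum, hence the threshold
     [q / 2]. *)
  have /fine_cvgP[fin /cvgrPdist_lt /(_ (q / 2))] := YC delta delta0.
  rewrite divr_gt0// => /(_ isT) small.
  near=> n.
  have n0 : (0 < n)%N by near: n; exact: nbhs_infty_gt.
  rewrite sub0r normrN ger0_norm; last exact: bigmax_ge_id.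
  apply: bigmax_le => [|i _]; first exact: ltW.
  rewrite leNgt; apply/negP => dc.
  have [law indep] := hxi n.
  have : (q%:E <= Pr n [set t | delta <= `|c n i * xi n i t|]%R)%E.
    rewrite -tailE -(law i _ (measurable_abs_ge 1 (@measurable_id _ R setT))).
    rewrite /distribution /pushforward; apply: le_measure; rewrite ?inE.
    - exact: (measurable_abs_ge 1 (measurable_funPT (xi n i))).
    - by apply: measurable_abs_ge; exact: measurable_funM.
    move=> t /= x1; rewrite normrM (ger0_norm (c0 n i)).
    by rewrite -[delta]mulr1 ler_pM// ltW.
  move=> /le_trans /(_ (coordinate_tail_le (@gaussian_sym n) indep i (c n) delta)).
  rewrite -YS//.
  have fn : Pr n [set w | delta <= `|Y n w - mu|] \is a fin_num by near: n.
  have : `|0 - fine (Pr n [set w | delta <= `|Y n w - mu|])| < q / 2 by near: n.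
  rewrite sub0r normrN ger0_norm; last exact: fine_ge0.
  rewrite -(fineK fn) -EFinD lee_fin /= => ? ?; lra.
- have [M EM] : exists M : R, (\int[normal_prob 0 sigma]_x (x ^+ 2)%:E)%E = M%:E.
    have := normal_second_moment_lty sigma0.
    have : (0 <= \int[normal_prob 0 sigma]_x (x ^+ 2)%:E)%E.
      by apply: integral_ge0 => x _; rewrite lee_fin sqr_ge0.
    by case: (\int[_]_x _)%E => // M _ _; exists M.
  pose b n := eps ^- 2 * ((\big[Num.max/0]_(i < n) c n i) * M).
  have bC : b n @[n --> \oo] --> 0.
    suff : b n @[n --> \oo] --> eps ^- 2 * (0 * M) by rewrite mul0r mulr0.
    by apply: cvgM; [exact: cvg_cst|apply: cvgM => //; exact: cvg_cst].
  apply: (@squeeze_cvge _ _ _ _ (cst 0%E) _ (fun n => (b n)%:E)).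
  + near=> n.
    have n0 : (0 < n)%N by near: n; exact: nbhs_infty_gt.
    rewrite measure_ge0/= YS//; apply: chebyshev_lin_comb => //; first exact: c1.
    by move=> i; exact: le_bigmax.
  + exact: cvg_cst.
  + by apply: cvg_EFin => //; exact: nearW.
Unshelve. all: by end_near.
Qed.

End WeightedMean.

(** * Averages of the dynamics as weighted means of the initial opinions *)

Lemma mnorm1_scaled (R : realType) n (A : 'M[R]_n) : (forall i j, 0 <= A i j) ->
  mnorm1 (n%:R^-1 *: A) =
  \big[Num.max/0]_(j < n) (n%:R^-1 * \sum_i A i j).
Proof.
move=> A0; apply: eq_bigr => j _; rewrite mulr_sumr; apply: eq_bigr => i _.
by rewrite mxE ger0_norm// mulr_ge0.
Qed.

Section Averages.
Context {R : realType} (mu : R) (P : forall n, 'M[R]_n) {d : nat -> measure_display}.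
Context {T : forall n, measurableType (d n)} {Pr : forall n, probability (T n) R}.
Context (xi : forall n, 'I_n -> {RV Pr n >-> R}).
Arguments xi : clear implicits.

Lemma mulmx_init n (u : 'rV[R]_n) t : \sum_i u ord0 i = 1 ->
  (u *m init_state mu xi t) ord0 ord0 = mu + lin_comb (xi n) (u ord0) t.
Proof.
move=> u1; rewrite mxE -[mu in RHS]mulr1 -u1 mulr_sumr -big_split/=.
by apply: eq_bigr => i _; rewrite mxE mulrDr mulrC.
Qed.

(** This is the weight of the [j]-th entry of [x] in the average of [A *m x]. *)
Definition column_average n (A : 'M[R]_n) (j : 'I_n) : R := n%:R^-1 * \sum_i A i j.

Lemma column_average_ge0 n (A : 'M[R]_n) j : stochastic A -> 0 <= column_average A j.
Proof. by case=> A0 _; rewrite mulr_ge0// sumr_ge0. Qed.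

Lemma sum_column_average n (A : 'M[R]_n) : (0 < n)%N -> stochastic A ->
  \sum_j column_average A j = 1.
Proof.
move=> n0 [_ A1]; rewrite -mulr_sumr exchange_big/=.
under eq_bigr do rewrite A1.
by rewrite sumr_const card_ord mulVf// pnatr_eq0 -lt0n.
Qed.

Lemma ave_state n k t : (0 < n)%N -> stochastic (P n) ->
  ave (state mu P xi n k t) = mu + lin_comb (xi n) (column_average (P n ^+ k)) t.
Proof.
move=> n0 hP; have hPk := stochasticX k hP.
pose u : 'rV[R]_n := \row_j column_average (P n ^+ k) j.
have uE j : u ord0 j = column_average (P n ^+ k) j by rewrite mxE.
have u1 : \sum_j u ord0 j = 1.
  by under eq_bigr do rewrite uE; exact: sum_column_average.
rewrite /ave /state trajE; under eq_bigr do rewrite mxE.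
rewrite exchange_big mulr_sumr.
transitivity ((u *m init_state mu xi t) ord0 ord0).
  rewrite mxE; apply: eq_bigr => j _.
  by rewrite uE /column_average -mulr_suml mulrA.
rewrite mulmx_init//; congr (_ + _); apply: eq_bigr => i _; by rewrite uE.
Qed.

Lemma ave_state_cvg n (pi : 'rV[R]_n) t : (0 < n)%N ->
  stochastic (P n) -> primitive (P n) ->
  (forall i, 0 <= pi ord0 i) -> \sum_i pi ord0 i = 1 -> pi *m P n = pi ->
  (fun k => ave (state mu P xi n k t)) @ \oo --> mu + lin_comb (xi n) (pi ord0) t.
Proof.
move=> n0 hP pP pi0 pi1 piP; rewrite -mulmx_init//.
set a := (pi *m _) ord0 ord0.
(* All coordinates share the limit [a]; written as an average of [n] copies, it is reached term by
   term. *)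
have -> : a = n%:R^-1 * \sum_(i < n) a.
  by rewrite sumr_const card_ord -[a *+ n]mulr_natl mulKf// pnatr_eq0 -lt0n.
rewrite /ave; apply: cvgMr; apply: cvg_big => [|i _]; first exact: add_continuous.
under eq_fun do rewrite /state trajE.
exact: primitive_power_cvg.
Qed.

End Averages.

(** * Choice of the weights for the three criteria *)

Theorem theorem1 (R : realType) (mu sigma : R) (hsigma : 0 < sigma)
  (P : forall n, 'M[R]_n) (hP : forall n, stochastic (P n))
  (d : nat -> measure_display) (T : forall n, measurableType (d n))
  (Pr : forall n, probability (T n) R)
  (xi : forall n, 'I_n -> {RV Pr n >-> R})
  (hxi : iid_gaussian sigma xi) :
  (one_time_wise mu P xi <->
     (fun n => mnorm1 (n%:R^-1 *: P n)) @ \oo --> 0) /\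
  (finite_time_wise mu P xi <->
     forall k : nat, (fun n => mnorm1 (n%:R^-1 *: (P n ^+ k))) @ \oo --> 0) /\
  ((forall n, (0 < n)%N -> primitive (P n)) ->
   forall pi : forall n, 'rV[R]_n,
     (forall n, (0 < n)%N ->
        [/\ forall i, 0 <= pi n ord0 i,
            \sum_(i < n) pi n ord0 i = 1 &
            pi n *m P n = pi n]) ->
     (wise mu P xi <-> (fun n => vnorm_inf (pi n)) @ \oo --> 0)).
Proof.
have finite_time k : cvg_in_prob Pr (fun n w => ave (state mu P xi n k w)) mu <->
    (fun n => mnorm1 (n%:R^-1 *: (P n ^+ k))) @ \oo --> 0.
  have hPk n : stochastic (P n ^+ k) := stochasticX k (hP n).
  under eq_fun => n do rewrite (mnorm1_scaled (hPk n).1).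
  apply: (weighted_mean_cvg hsigma hxi (c := fun n => column_average (P n ^+ k))).
  - by move=> n i; exact: column_average_ge0.
  - by move=> n n0; exact: sum_column_average.
  - by move=> n t n0; exact: ave_state.
split; first exact: (finite_time 1%N).
split; first by split=> h k; apply/finite_time; exact: h.
move=> pP pi piP.
have ave_cvg n (w : T n) : (0 < n)%N ->
    (fun k => ave (state mu P xi n k w)) @ \oo -->
    mu + lin_comb (xi n) (pi n ord0) w.
  by move=> n0; have [pi0 pi1 piPn] := piP n n0; apply: ave_state_cvg => //; exact: pP.
have pi_ge0 n (i : 'I_n) : 0 <= pi n ord0 i.
  by have [pi0 _ _] := piP n (leq_ltn_trans (leq0n i) (ltn_ord i)); exact: pi0.
have -> : (fun n => vnorm_inf (pi n)) =
    (fun n => \big[Num.max/0]_(i < n) pi n ord0 i).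
  by apply/funext => n; apply: eq_bigr => i _; rewrite ger0_norm.
have wiseE : cvg_in_prob Pr (fun n w => limn (fun k => ave (state mu P xi n k w))) mu
    <-> (fun n => \big[Num.max/0]_(i < n) pi n ord0 i) @ \oo --> 0.
  apply: (weighted_mean_cvg hsigma hxi (c := fun n => pi n ord0)) => //.
  - by move=> n n0; have [] := piP n n0.
  - by move=> n w n0; apply/cvg_lim => //; exact: ave_cvg.
split=> [[_ /wiseE]//|h]; split; last exact/wiseE.
(* [wise] asks for convergence in [k] at every [n]; in dimension 0 the average is an empty sum,
   constantly 0. *)
move=> n w; have [n0|n0] := posnP n; last by apply/cvg_ex; eexists; exact: ave_cvg.
suff -> : (fun k => ave (state mu P xi n k w)) = cst 0 by exact: is_cvg_cst.
apply/funext => k; rewrite /ave big1 ?mulr0// => i _.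
by have := ltn_ord i; rewrite {2}n0.
Qed.
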